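(* Let $D\in\mathbb{N}$, let $U=\mathcal{T}_D$, and let $L$ be a relative involutive division on $U$. Let $M\subseteq U$ and let $J=(M)$ be the semigroup ideal generated by $M$. Then $$J=\bigcup_{l\in M}C_L(l,U)\iff M\text{ is compliant}.$$
   Context: $\mathcal{T}$ is the set (monoid) of all terms (monic monomials) $x_1^{\gamma_1}\cdots x_n^{\gamma_n}$ in the variables $x_1,\dots,x_n$, and $\mathcal{T}_D$ is the set of terms of degree $D$. The semigroup ideal generated by a set $M$ of terms is $(M)=\{\tau m:\tau\in\mathcal{T},m\in M\}$. A relative involutive division $L$ on a finite set $U\subset\mathcal{T}$ is the assignment, to each $u\in U$, of a partition $\{x_1,\dots,x_n\}=M_L(u,U)\sqcup NM_L(u,U)$ of the variables into multiplicative and non-multiplicative ones such that, setting $L(u,U)=\{x_1^{a_1}\cdots x_n^{a_n} : a_i\ne 0\Rightarrow x_i\in M_L(u,U)\}$ and $C_L(u,U)=uL(u,U)=\{uw: w\in L(u,U)\}$ (the cone of $u$): (1) the semigroup ideal generated by $U$ equals $\bigcup_{u\in U}C_L(u,U)$; (2) $C_L(u,U)\cap C_L(v,U)=\emptyset$ for all distinct $u,v\in U$. For $s,t\in U$, $X(s,t)$ denotes the unique element of $U$ with $\operatorname{lcm}(s,t)\in C_L(X(s,t),U)$. A set $M\subseteq U$ is called compliant if for all $s,t\in U$: $t\in M$ implies $X(s,t)\in M$. *)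

(* Defs.v *)
From mathcomp Require Import all_boot.
From mathcomp Require Import mpoly.
From mathcomp Require Import boolp classical_sets functions cardinality.

Set Implicit Arguments.
Unset Strict Implicit.
Unset Printing Implicit Defensive.

Local Open Scope classical_set_scope.

(* A term x_1^g_1 ... x_n^g_n is its exponent vector in 'X_{1..n}; the product
   of terms is (_ + _)%MM and their lcm is mlcm. *)

Definition terms_of_degree (n D : nat) : set 'X_{1..n} :=
  [set t | mdeg t = D].
Arguments terms_of_degree n D : clear implicits.

Definition sgideal (n : nat) (M : set 'X_{1..n}) : set 'X_{1..n} :=
  [set (tau + m)%MM | tau in setT & m in M].

Definition terms_in (n : nat) (V : {set 'I_n}) : set 'X_{1..n} :=
  [set w : 'X_{1..n} | forall i, w i <> 0 -> i \in V].

Definition cone_of (n : nat) (V : {set 'I_n}) (u : 'X_{1..n}) : set 'X_{1..n} :=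
  [set (u + w)%MM | w in terms_in V].

(* A partition of the variables in two classes is given by its first class
   [mult u]; the second one is its complement, see [nonmult]. The values of
   [mult] outside U are never used. *)
Record rel_inv_division (n : nat) (U : set 'X_{1..n}) := RelInvDivision {
  mult : 'X_{1..n} -> {set 'I_n};
  division_finite : finite_set U;
  division_cover : sgideal U = \bigcup_(u in U) cone_of (mult u) u;
  division_disjoint : forall u v, U u -> U v -> u <> v ->
    cone_of (mult u) u `&` cone_of (mult v) v = set0 }.

Section Division.
Variables (n : nat) (U : set 'X_{1..n}) (L : rel_inv_division U).

Definition nonmult (u : 'X_{1..n}) : {set 'I_n} := (~: mult L u)%SET.

Definition cone (u : 'X_{1..n}) : set 'X_{1..n} := cone_of (mult L u) u.

(* For s, t in U the default value s of [xget] is irrelevant, see [lcm_coneP]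
   and [lcm_cone_uniq]. *)
Definition lcm_cone (s t : 'X_{1..n}) : 'X_{1..n} :=
  xget s [set u | U u /\ cone u (mlcm s t)].

Definition compliant (M : set 'X_{1..n}) : Prop :=
  forall s t, U s -> U t -> M t -> M (lcm_cone s t).

Lemma lcm_coneP s t : U s -> U t ->
  U (lcm_cone s t) /\ cone (lcm_cone s t) (mlcm s t).
Proof.
move=> Us Ut.
have : sgideal U (mlcm s t).
  exists (t - s)%MM => //; exists s => //.
  by apply/mnmP => i; rewrite !mnmE maxnE addnC.
rewrite (division_cover L) => -[u Uu Cu].
exact: (@xgetPex _ s [set u | U u /\ cone u (mlcm s t)] (ex_intro _ u (conj Uu Cu))).
Qed.

Lemma lcm_cone_uniq s t u : U s -> U t ->
  U u -> cone u (mlcm s t) -> u = lcm_cone s t.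
Proof.
move=> Us Ut Uu Cu; have [UX CX] := lcm_coneP Us Ut.
apply: contrapT => neq.
have : (cone u `&` cone (lcm_cone s t)) (mlcm s t) by [].
by rewrite /cone (division_disjoint L Uu UX neq).
Qed.

End Division.

Lemma finite_terms_of_degree (n D : nat) : finite_set (terms_of_degree n D).
Proof.
apply: (@sub_finite_set _ _ [set bmnm m | m in [set: 'X_{1..n < D.+1}]]).
  move=> t /= Dt; have lt_t : mdeg t < D.+1 by rewrite Dt.
  by exists (BMultinom lt_t).
exact/finite_image/finite_finset.
Qed.

(* Main.v *)
Require Import Defs.
From mathcomp Require Import all_boot.
From mathcomp Require Import mpoly.
From mathcomp Require Import boolp classical_sets.

(** Everything rests on one remark: a cone [C(u)] is closed under passing from
    a term [w] to any divisor of [w] that is still a multiple of [u]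
    ([cone_of_interval]).

    Suppose [M] is compliant, and let [w] be a multiple of some [t] in [M].
    The cones cover, so [w] lies in [C(u)] for some [u] in [U]; both [u] and
    [t] divide [w], hence so does [lcm(u, t)], which therefore lies in [C(u)]
    by the remark. By disjointness of the cones [u = X(u, t)], and compliance
    puts [u] in [M].

    Conversely, suppose that the cones of [M] cover [J]. For [t] in [M], the
    multiple [lcm(s, t)] of [t] is in [J], hence in the cone of an element of
    [M]; by disjointness this element is [X(s, t)]. *)

Local Open Scope classical_set_scope.

Set Implicit Arguments.
Unset Strict Implicit.

Lemma sgidealP n (M : set 'X_{1..n}) w :
  sgideal M w <-> exists2 m, M m & (m <= w)%MM.
Proof.
split=> [[tau _ [m Mm <-]]|[m Mm le_mw]].
  by exists m => //; apply: lem_addl.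
by exists (w - m)%MM => //; exists m => //; rewrite submK.
Qed.

Lemma sgidealS n (M N : set 'X_{1..n}) : M `<=` N -> sgideal M `<=` sgideal N.
Proof.
by move=> MN w /sgidealP [m /MN Nm le_mw]; apply/sgidealP; exists m.
Qed.

Lemma cone_of_lem n (V : {set 'I_n}) (u w : 'X_{1..n}) :
  cone_of V u w -> (u <= w)%MM.
Proof. by case=> v _ <-; apply: lem_addr. Qed.

(** The quotient [x / u] divides [w / u], so it only involves variables that
    already occur in [w / u]. *)
Lemma cone_of_interval n (V : {set 'I_n}) (u x w : 'X_{1..n}) :
  (u <= x)%MM -> (x <= w)%MM -> cone_of V u w -> cone_of V u x.
Proof.
move=> le_ux le_xw [v Vv def_w]; exists (x - u)%MM; last first.
  by rewrite addmC submK.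
move=> i xu_i; apply: Vv => v_i0; apply: xu_i.
move/mnm_lepP: le_xw => /(_ i).
rewrite -def_w mnmDE mnmBE v_i0 addn0 => le_xu.
by apply/eqP; rewrite subn_eq0.
Qed.

Section Compliance.
Variables (n : nat) (U : set 'X_{1..n}) (L : rel_inv_division U).

(** The term [lcm(u, t)] lies between [u] and [w], hence in the cone of [u].
    This is what lets compliance, which speaks of lcms only, control every
    multiple of [t]. *)
Lemma cone_lcm_cone u t w :
  U u -> U t -> cone L u w -> (t <= w)%MM -> u = lcm_cone L u t.
Proof.
move=> Uu Ut Cuw le_tw; have le_uw := cone_of_lem Cuw.
apply: lcm_cone_uniq => //.
by apply: cone_of_interval Cuw; rewrite ?lem_mlcml // lem_mlcm le_uw.
Qed.

Lemma bigcup_cone_sub_sgideal M : \bigcup_(l in M) cone L l `<=` sgideal M.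
Proof.
by move=> w [l Ml /cone_of_lem le_lw]; apply/sgidealP; exists l.
Qed.

Lemma sgideal_cones_compliant M : M `<=` U ->
  sgideal M = \bigcup_(l in M) cone L l <-> compliant L M.
Proof.
move=> MU; split=> [JE s t Us Ut Mt|ML].
  have : sgideal M (mlcm s t).
    by apply/sgidealP; exists t => //; apply: lem_mlcmr.
  rewrite JE => -[l Ml Cl].
  by rewrite -(lcm_cone_uniq Us Ut (MU _ Ml) Cl).
apply/seteqP; split; last exact: bigcup_cone_sub_sgideal.
move=> w Jw; have : sgideal U w by apply: sgidealS Jw.
rewrite (division_cover L) => -[u Uu Cuw].
move/sgidealP: Jw => [t Mt le_tw].
exists u => //; rewrite (cone_lcm_cone Uu (MU _ Mt) Cuw le_tw).
exact: ML Uu (MU _ Mt) Mt.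
Qed.

End Compliance.

Unset Implicit Arguments.
Set Strict Implicit.

Theorem proposition33 (n D : nat)
    (L : rel_inv_division (terms_of_degree n D))
    (M : set 'X_{1..n}) (MU : M `<=` terms_of_degree n D) :
  sgideal M = \bigcup_(l in M) cone L l <-> compliant L M.
Proof. exact: sgideal_cones_compliant. Qed.
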